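(* Let $k,m,n$ be natural numbers with $2\le k<n$ and $m<n$, and suppose that $p=\frac mn\ge 0.5$ and $\varepsilon=\frac kn$. Then $$\exp\left\{\frac{2\varepsilon^2 n}{1+\varepsilon^2}\right\}\cdot S_{j+1}\le S_j,\qquad j=1,\dots,r-1.$$ Therefore, $$\left(\exp\left\{\frac{2\varepsilon^2 n}{1+\varepsilon^2}\right\}-1\right)\mathcal{P}^-_2\le \mathcal{P}^-_1.$$
   Context: Natural numbers are positive integers. $X_1,\dots,X_n$ are independent random variables with $\mathbf{Pr}(X_i=1)=p$, $\mathbf{Pr}(X_i=0)=1-p$. The left groups of binomial probabilities are $$S_j:=\sum_{\ell=m-kj}^{m-1-(j-1)k}\binom{n}{\ell}p^\ell(1-p)^{n-\ell},\qquad j=1,\dots,r,$$ where $r=\lceil m/k\rceil$ is the number of left groups and terms with $\ell<0$ are taken to be zero (so the last group may be incomplete). Further, $$\mathcal{P}^-_1:=\mathbf{Pr}\left(0<p-\frac1n\sum_{i=1}^nX_i\le\varepsilon\right),\qquad \mathcal{P}^-_2:=\mathbf{Pr}\left(\varepsilon<p-\frac1n\sum_{i=1}^nX_i\right).$$ *)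

(* Defs.v *)
From HB Require Import structures.
From mathcomp Require Export all_boot all_order all_algebra.
From mathcomp Require Export all_classical all_reals all_analysis.
Export Order.TTheory GRing.Theory Num.Theory.
Export numFieldNormedType.Exports.

Set Implicit Arguments.
Unset Strict Implicit.
Unset Printing Implicit Defensive.

Local Open Scope classical_set_scope.
Local Open Scope ring_scope.

Definition independent_RVs d d' (T : measurableType d) (T' : measurableType d')
    (R : realType) (P : probability T R) (I : finType)
    (X : I -> {RV P >-> T'}) : Prop :=
  forall (J : {set I}) (B : I -> set T'),
    (forall i, i \in J -> measurable (B i)) ->
    P (\bigcap_(i in [set` J]) (X i @^-1` B i)) =
      (\prod_(i in J) P (X i @^-1` B i))%E.

Definition num_left_groups (m k : nat) : nat :=
  `|Num.ceil (m%:R / k%:R : rat)|%N.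

(* The indices run from m - k * j to m - 1 - (j - 1) * k.  The subtraction of
   [nat] truncates the lower bound at 0, which drops exactly the terms of
   negative index; the upper bound is not truncated for
   1 <= j <= num_left_groups m k, as then (j - 1) * k < m. *)
Definition left_group (R : realType) (n m k : nat) (p : R) (j : nat) : R :=
  \sum_(m - k * j <= l < m - j.-1 * k)
    'C(n, l)%:R * p ^+ l * (1 - p) ^+ (n - l).

Section deviations.
Context d (T : measurableType d) (R : realType) (P : probability T R).
Context (n : nat) (X : 'I_n -> {RV P >-> R}) (p eps : R).

Definition small_left_deviation : \bar R :=
  P [set t | 0 < p - n%:R^-1 * \sum_(i < n) X i t <= eps].

Definition large_left_deviation : \bar R :=
  P [set t | eps < p - n%:R^-1 * \sum_(i < n) X i t].

End deviations.

(* Main.v *)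
From mathcomp Require Import ring lra zify.
Require Import Defs.

(** Let b(l) be the probability that a binomial variable with parameters n and
    p = m/n equals l.  Both inequalities follow from one pointwise estimate:
    - b(l - k) * exp(2k(k + 1)/n) <= b(l)  for k <= l < m;
    and 2 eps^2 n / (1 + eps^2) <= 2 eps^2 n = 2k^2/n <= 2k(k + 1)/n.

    For the pointwise estimate ([binomial_pmf_shift]), climb from l - k to l
    one unit at a time.  At the step from s to s + 1, where s + i < m, the
    ratio b(s+1)/b(s) = (n - s) p / ((s + 1)(1 - p)) is at least
    (a + i) m / (a (m - i)) with a = n - m.  Since
    (a + i)/a = (1 + u)/(1 - u) for u = i/(2a + i), and
    m/(m - i) = (1 + v)/(1 - v) for v = i/(2m - i), the inequality
    exp(2u) <= (1 + u)/(1 - u) bounds this ratio below by exp(2u + 2v), and the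
    arithmetic-harmonic mean inequality gives 2u + 2v >= 4i/n
    ([expR_le_ratio]).  The steps i = k, ..., 1 multiply to the exponent
    4(1 + ... + k)/n = 2k(k + 1)/n.

    Summed over a range of indices ([binomial_sum_shift]), the estimate compares
    S_(j+1), shifted by k, with S_j.  Summed over all l < m - k, it says that
    exp(...) * Pr(sum X < m - k) <= Pr(sum X < m); as
    P2 = Pr(sum X < m - k) and P1 + P2 = Pr(sum X < m), this is the second
    inequality.  That sum X has the binomial law, although each X_i takes the
    values 0 and 1 only almost surely, is [binomial_law]. *)

Local Open Scope classical_set_scope.
Local Open Scope ring_scope.

(** * An exponential bound for the ratio of consecutive binomial weights *)

(** Multiplied by exp(-u), this says that (1 + u) exp(-u) - (1 - u) exp(u), which
    vanishes at 0, is nonnegative; its derivative is u (exp(u) - exp(-u)). *)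
Lemma expR_mul_onem_le (R : realType) (u : R) :
  0 <= u -> expR (2 * u) * (1 - u) <= 1 + u.
Proof.
move=> u0.
pose f (x : R) : R := (1 + x) * expR (- x) - (1 - x) * expR x.
have df (x : R) : is_derive x 1 f (x * (expR x - expR (- x))).
  rewrite /f; apply: is_derive_eq; rewrite /GRing.scale/=; ring.
have dfE (x : R) : derive1 f x = x * (expR x - expR (- x)).
  by rewrite derive1E derive_val.
have : f 0 <= f u.
  apply: (@ger0_derive1_ndecry _ f 0) => //.
  - move=> x; rewrite in_itv/= andbT => x0; rewrite dfE.
    by rewrite mulr_ge0 ?subr_ge0 ?ler_expR ?ltW// gtrN.
  - apply: continuous_subspaceT => x.
    by apply/differentiable_continuous/derivable1_diffP.
rewrite /f oppr0 !addr0 expR0 subrr subr_ge0 => h.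
rewrite mulr2n mulrDl mul1r expRD -mulrA (mulrC (expR u) (1 - u)).
rewrite (le_trans (ler_wpM2l (expR_ge0 u) h))//.
by rewrite mulrCA -expRD subrr expR0 mulr1.
Qed.

(** With u = i / (2a + i) and v = i / (2m - i), the factors (a + i)/a and m/(m - i)
    are (1 + u)/(1 - u) >= exp(2u) and (1 + v)/(1 - v) >= exp(2v).  The point of
    this form is that u and v are i divided by two numbers whose sum, 2(a + m),
    does not involve i. *)
Lemma expR_le_ratio (R : realType) (a m i : R) :
  0 < a -> 0 <= i < m ->
  expR (4 * i / (a + m)) * (a * (m - i)) <= (a + i) * m.
Proof.
move=> a0 /andP[i0 im].
pose u := i / (2 * a + i); pose v := i / (2 * m - i).
have a0' : 0 < 2 * a + i by lra.
have m0' : 0 < 2 * m - i by lra.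
have u0 : 0 <= u by rewrite divr_ge0// ltW.
have v0 : 0 <= v by rewrite divr_ge0// ltW.
have hu : expR (2 * u) * a <= a + i.
  have := ler_wpM2r (ltW a0') (expR_mul_onem_le _ _ u0).
  have -> : (1 + u) * (2 * a + i) = 2 * (a + i) by rewrite /u; field; lra.
  rewrite -mulrA; have -> : (1 - u) * (2 * a + i) = 2 * a by rewrite /u; field; lra.
  lra.
have hv : expR (2 * v) * (m - i) <= m.
  have := ler_wpM2r (ltW m0') (expR_mul_onem_le _ _ v0).
  have -> : (1 + v) * (2 * m - i) = 2 * m by rewrite /v; field; lra.
  rewrite -mulrA; have -> : (1 - v) * (2 * m - i) = 2 * (m - i) by rewrite /v; field; lra.
  lra.
(* The arithmetic-harmonic mean inequality for 2a + i and 2m - i, whose sum is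
   2(a + m). *)
have huv : 4 * i / (a + m) <= 2 * u + 2 * v.
  rewrite -subr_ge0.
  have -> : 2 * u + 2 * v - 4 * i / (a + m) =
      4 * i * (a - m + i) ^+ 2 / ((2 * a + i) * (2 * m - i) * (a + m)).
    rewrite /u /v; field; apply/and3P; split; lra.
  apply: divr_ge0; first by apply: mulr_ge0 (sqr_ge0 _); lra.
  by apply: mulr_ge0; [apply: mulr_ge0|]; lra.
have := ler_pM _ _ hu hv.
rewrite !mulr_ge0 ?expR_ge0; try lra.
move=> /(_ isT isT); apply: le_trans.
rewrite mulrACA -expRD; apply: ler_wpM2r; last by rewrite ler_expR.
by rewrite mulr_ge0; lra.
Qed.

Lemma binomial_pmf_succ (R : realType) (n : nat) (q : R) (s : nat) : (s < n)%N ->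
  binomial_pmf n q s.+1 * s.+1%:R * (1 - q) =
    binomial_pmf n q s * (n - s)%:R * q.
Proof.
move=> sn; rewrite /binomial_pmf /unstable.onem.
rewrite (_ : (n - s)%N = (n - s.+1).+1); last by lia.
rewrite -(mulr_natr _ 'C(n, s.+1)) -(mulr_natr _ 'C(n, s)) !exprS.
have : 'C(n, s.+1)%:R * s.+1%:R = 'C(n, s)%:R * (n - s.+1).+1%:R :> R.
  rewrite -!natrM mulnC mul_bin_left; congr (_%:R).
  by rewrite mulnC; congr muln; lia.
move=> h.
transitivity (q * q ^+ s * (1 - q) ^+ (n - s.+1) * (1 - q) *
    ('C(n, s.+1)%:R * s.+1%:R)); first by ring.
rewrite h; ring.
Qed.

Lemma binomial_pmf_step (R : realType) (m n i s : nat) (p : R) :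
  (m < n)%N -> p = m%:R / n%:R -> (s + i < m)%N ->
  expR (4 * i%:R / n%:R) * binomial_pmf n p s <= binomial_pmf n p s.+1.
Proof.
move=> m_lt_n -> {p} sim.
set p : R := m%:R / n%:R; set b := binomial_pmf n p.
have n0 : 0 < n%:R :> R by rewrite ltr0n; lia.
have mn : m%:R < n%:R :> R by rewrite ltr_nat.
pose a : R := n%:R - m%:R.
have a0 : 0 < a by rewrite subr_gt0.
have s0 : 0 < s.+1%:R :> R by rewrite ltr0n.
have m0 : 0 < m%:R :> R by rewrite ltr0n; lia.
have sim' : s.+1%:R + i%:R <= m%:R :> R by rewrite -natrD ler_nat.
have i0 : 0 <= i%:R :> R by [].
have p01 : 0 <= p <= 1.
  by rewrite divr_ge0//= ler_pdivrMr// mul1r ltW.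
have b0 : 0 <= b s by exact: binomial_pmf_ge0.
have hb : b s.+1 * (s.+1%:R * a) = b s * ((n - s)%:R * m%:R).
  have /(congr1 ( *%R^~ n%:R)) := binomial_pmf_succ R n p s (ltac:(lia)).
  have -> : 1 - p = a / n%:R by rewrite /p /a; field; lra.
  rewrite /p; rewrite -!mulrA !mulVf ?mulr1 ?gt_eqF// => ->; ring.
(* By the recurrence, it suffices to bound exp(4i/n) by the ratio of successive
   weights; n - s >= a + i and s + 1 <= m - i reduce this to the bound on
   (a + i) m / (a (m - i)). *)
rewrite -(ler_pM2r (mulr_gt0 s0 a0)) hb.
have -> : (n - s)%:R = n%:R - s%:R :> R by rewrite natrB//; lia.
rewrite (mulrC (expR _)) -[leLHS]mulrA; apply: ler_wpM2l => //.
apply: (@le_trans _ _ (expR (4 * i%:R / n%:R) * (a * (m%:R - i%:R)))).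
  apply: ler_wpM2l; first exact: expR_ge0.
  by rewrite (mulrC _ a) ler_pM2l//; lra.
have -> : n%:R = a + m%:R by rewrite /a; ring.
apply: le_trans (expR_le_ratio _ _ _ _ a0 _) _; first by apply/andP; lra.
apply: ler_wpM2r; first exact: ltW.
move: sim'; rewrite -natr1; lra.
Qed.

(** The exponent is 4(1 + ... + k)/n: the slack i in s + i < m, hence the rate of
    growth, is k at the first step up from s and drops to 1 at the last one. *)
Lemma binomial_pmf_shift (R : realType) (m n k s : nat) (p : R) :
  (m < n)%N -> p = m%:R / n%:R -> (s + k < m)%N ->
  expR (2 * k%:R * k.+1%:R / n%:R) * binomial_pmf n p s <=
    binomial_pmf n p (s + k)%N.
Proof.
move=> m_lt_n pE.
have n0 : n%:R != 0 :> R by rewrite pnatr_eq0; lia.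
elim: k s => [|k IH] s skm.
  by rewrite mulr0 !mul0r expR0 mul1r addn0.
have -> : 2 * k.+1%:R * k.+2%:R / n%:R =
    2 * k%:R * k.+1%:R / n%:R + 4 * k.+1%:R / n%:R :> R.
  by rewrite -(natr1 k.+1) -(natr1 k); field.
rewrite expRD -mulrA addnS -addSn.
apply: le_trans (IH s.+1 _); last by lia.
by apply: ler_wpM2l (binomial_pmf_step _ _ _ _ _ _ m_lt_n pE skm); exact: expR_ge0.
Qed.

(** The shift by k carries [a, b - k) to [a + k, b).  Allowing a' < a + k covers both
    a lower end that was truncated at 0 and the comparison of a whole tail,
    a = a' = 0, with a larger one. *)
Lemma binomial_sum_shift (R : realType) (m n k a a' b : nat) (p c : R) :
    (m < n)%N -> p = m%:R / n%:R -> c <= expR (2 * k%:R * k.+1%:R / n%:R) ->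
    (b <= m)%N -> (a' <= a + k)%N ->
  c * \sum_(a <= l < b - k) binomial_pmf n p l <=
    \sum_(a' <= l < b) binomial_pmf n p l.
Proof.
move=> m_lt_n pE hc b_le_m a'_le.
have p01 : 0 <= p <= 1.
  rewrite pE divr_ge0//= ler_pdivrMr ?ltr0n; last by lia.
  by rewrite mul1r ler_nat ltnW.
have pmf_ge0 l : 0 <= binomial_pmf n p l by exact: binomial_pmf_ge0.
apply: (@le_trans _ _ (\sum_(a + k <= l < b) binomial_pmf n p l)).
  rewrite big_addn mulr_sumr; apply: ler_sum_nat => l /andP[_ lb].
  apply: le_trans (binomial_pmf_shift _ m n _ _ _ m_lt_n pE _); last by lia.
  exact: ler_wpM2r.
rewrite (big_nat_widenl _ a')// [leLHS]big_mkcond; apply: ler_sum => l _ /=.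
by case: ifP.
Qed.

(** * The law of the sum *)

(** The 2^n events that fix every X_i to be 0 or 1 are disjoint, and their
    probabilities add up to (p + (1 - p))^n = 1.  Those with an admissible number
    of ones give a lower bound for the probability of D, and, applied to the
    complement of D, an upper bound; the two agree.  Thus the null set on which
    some X_i is neither 0 nor 1 never has to be considered. *)
Lemma binomial_law (R : realType) d (T : measurableType d)
    (P : probability T R) (n : nat) (p : R) (X : 'I_n -> {RV P >-> R})
    (X_indep : independent_RVs X)
    (X_eq1 : forall i, P [set t | X i t = 1] = p%:E)
    (X_eq0 : forall i, P [set t | X i t = 0] = (1 - p)%:E)
    (D : set R) : measurable D ->
  P [set t | D (\sum_(i < n) X i t)] =
    (\sum_(l < n.+1 | `[< D l%:R >]) binomial_pmf n p l)%:E.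
Proof.
pose value (J : {set 'I_n}) (i : 'I_n) : R := (i \in J)%:R.
pose E J := \bigcap_(i in [set` [set: 'I_n]%SET]) (X i @^-1` [set value J i]).
have mX i (x : R) : measurable (X i @^-1` [set x]).
  by rewrite -[_ @^-1` _]setTI; apply: measurable_funP.
have mE J : measurable (E J).
  by apply: fin_bigcap_measurable => // i _; exact: mX.
have PE J : P (E J) = (p ^+ #|J| * (1 - p) ^+ (n - #|J|))%:E.
  rewrite /E X_indep; last by move=> i _; exact: measurable_set1.
  rewrite (eq_bigl xpredT); last by move=> i; rewrite inE.
  rewrite (eq_bigr (fun i => (if i \in J then p else 1 - p)%:E)); last first.
    by move=> i _; rewrite /value; case: (i \in J); [exact: X_eq1|exact: X_eq0].
  rewrite prodEFin big_if /= !big_const /= !iter_mulr !mulr1.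
  congr (_ * (1 - p) ^+ _)%:E.
  by have /(congr1 (subn^~ #|J|)) := cardC (mem J); rewrite card_ord addKn.
have sumE J t : E J t -> \sum_(i < n) X i t = #|J|%:R.
  move=> Et; rewrite (eq_bigr (fun i => (i \in J)%:R)); last first.
    by move=> i _; apply: Et => /=; rewrite inE.
  by rewrite -natr_sum -sum1_card [in RHS]big_mkcond; congr (_%:R).
have disjE : trivIset setT E.
  move=> J K _ _ [t [EJ EK]]; apply/setP => i.
  have : value J i = value K i.
    by rewrite -(EJ i) ?(EK i)//= inE.
  rewrite /value => /eqP; rewrite eqr_nat; by case: (i \in J); case: (i \in K).
pose w (Q : pred nat) := \sum_(l < n.+1 | Q l) binomial_pmf n p l.
have measE (Q : pred nat) :
    P (\bigcup_(J in [set J : {set 'I_n} | Q #|J|]) E J) = (w Q)%:E.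
  rewrite measure_fin_bigcup//; last 2 first.
  - exact: finite_finset.
  - exact: sub_trivIset disjE.
  rewrite -(@bigfs _ _ _ _ (index_enum _) (fun J : {set 'I_n} => Q #|J|)) ?index_enum_uniq//; last first.
    by move=> J _ /=; rewrite mem_index_enum.
  transitivity (\sum_(J : {set 'I_n} | Q #|J|)
      (p ^+ #|J| * (1 - p) ^+ (n - #|J|))%:E)%E.
    by apply: eq_bigr => J _; exact: PE.
  rewrite sumEFin; congr (_%:E).
  have cardJ (J : {set 'I_n}) : (#|J| < n.+1)%N.
    by rewrite ltnS -[X in (_ <= X)%N](card_ord n) max_card.
  rewrite (partition_big (fun J : {set 'I_n} => Ordinal (cardJ J)) (fun l => Q l))//=.
  apply: eq_bigr => l Ql.
  rewrite (eq_bigl (fun J => J \in [set J : {set 'I_n} | #|J| == l]%SET)); last first.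
    move=> J; rewrite inE -val_eqE/=; apply/andP/idP => [[]//|/eqP Jl].
    by rewrite Jl.
  rewrite (eq_bigr (fun J => p ^+ l * (1 - p) ^+ (n - l))); last first.
    by move=> J; rewrite inE => /eqP ->.
  by rewrite sumr_const card_draws card_ord.
have mS (C : set R) : measurable C -> measurable [set t | C (\sum_(i < n) X i t)].
  move=> mC; rewrite -[X in measurable X]setTI.
  by apply: (measurable_sum (index_enum 'I_n) (h := fun i => X i)).
have lower (C : set R) : measurable C ->
    ((w (fun l => `[< C l%:R >]))%:E <= P [set t | C (\sum_(i < n) X i t)%R])%E.
  move=> mC; rewrite -measE; apply: le_measure; rewrite ?inE.
  - by apply: fin_bigcup_measurable.
  - exact: mS.
  - by move=> t [J /= /asboolP CJ EJ]; rewrite (sumE J).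
have w1 (Q : pred nat) : w Q + w (fun l => ~~ Q l) = 1.
  transitivity (\sum_(l < n.+1) binomial_pmf n p l).
    by rewrite /w [RHS](bigID (fun l : 'I_n.+1 => Q l)).
  rewrite -[RHS](expr1n _ n) -[in RHS](subrK p 1) exprDn.
  by apply: eq_bigr => l _; rewrite /binomial_pmf mulrC.
move=> mD; pose Q l := `[< D l%:R >].
apply/eqP; rewrite eq_le (lower _ mD) andbT -/(w Q).
have := lower _ (measurableC mD).
rewrite (_ : (fun l => _) = (fun l => ~~ Q l)); last first.
  by apply/funext => l; rewrite asbool_neg.
rewrite (_ : [set t | _] = ~` [set t | D (\sum_(i < n) X i t)])//.
rewrite probability_setC; last exact: mS.
rewrite -[P _]fineK ?fin_num_measure//; last exact: mS.
rewrite -EFinB !lee_fin; have := w1 Q; lra.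
Qed.

(** * Comparison of the groups and of the tails *)

Lemma left_groupE (R : realType) (n m k j : nat) (p : R) :
  left_group n m k p j =
    \sum_(m - k * j <= l < m - j.-1 * k) binomial_pmf n p l.
Proof.
by apply: eq_bigr => l _; rewrite /binomial_pmf -[RHS]mulr_natr [RHS]mulrC mulrA.
Qed.

Theorem theorem4 (R : realType) (d : measure_display) (T : measurableType d)
    (P : probability T R) (k m n : nat) (p eps : R)
    (X : 'I_n -> {RV P >-> R})
    (m_gt0 : (0 < m)%N) (k_ge2 : (2 <= k)%N) (k_lt_n : (k < n)%N)
    (m_lt_n : (m < n)%N)
    (p_def : p = m%:R / n%:R) (p_ge_half : 1 / 2 <= p)
    (eps_def : eps = k%:R / n%:R)
    (X_indep : independent_RVs X)
    (X_eq1 : forall i, P [set t | X i t = 1] = p%:E)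
    (X_eq0 : forall i, P [set t | X i t = 0] = (1 - p)%:E) :
  (forall j : nat, (1 <= j <= (num_left_groups m k).-1)%N ->
     expR (2 * eps ^+ 2 * n%:R / (1 + eps ^+ 2)) * left_group n m k p j.+1
       <= left_group n m k p j) /\
  ((expR (2 * eps ^+ 2 * n%:R / (1 + eps ^+ 2)) - 1)%:E *
     large_left_deviation X p eps <= small_left_deviation X p eps)%E.
Proof.
have n0 : 0 < n%:R :> R by rewrite ltr0n; lia.
have nN0 : n%:R != 0 :> R by rewrite gt_eqF.
set c := expR _.
have c_le : c <= expR (2 * k%:R * k.+1%:R / n%:R).
  rewrite ler_expR ler_pdivrMr; last by rewrite ltr_pwDl ?sqr_ge0.
  have -> : 2 * eps ^+ 2 * n%:R = 2 * k%:R * k%:R / n%:R.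
    by rewrite eps_def; field.
  rewrite mulrDr mulr1 -[leLHS]addr0; apply: lerD.
    by rewrite ler_pM2r ?invr_gt0// ler_wpM2l ?mulr_ge0// ler_nat.
  by rewrite mulr_ge0 ?sqr_ge0 ?divr_ge0 ?mulr_ge0.
split.
  move=> j /andP[j1 _]; rewrite !left_groupE /=.
  have -> : (m - j * k = m - j.-1 * k - k)%N.
    by rewrite -subnDA -mulSnr prednK.
  apply: (binomial_sum_shift _ m) => //; first exact: leq_subr.
  by rewrite mulnS; lia.
have sumE a b : (b <= n.+1)%N ->
    \sum_(l < n.+1 | (a <= l < b)%N) binomial_pmf n p l =
    \sum_(a <= l < b) binomial_pmf n p l.
  move=> bn; rewrite (big_nat_widen _ _ n.+1)// (big_nat_widenl _ 0)//.
  by rewrite big_mkord; apply: eq_bigl => l; rewrite andTb andbC.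
have devE (s : R) : p - n%:R^-1 * s = (m%:R - s) / n%:R.
  by rewrite p_def; field.
have largeE : large_left_deviation X p eps =
    (\sum_(0 <= l < m - k) binomial_pmf n p l)%:E.
  have -> : large_left_deviation X p eps =
      P [set t | [set` `]-oo, (m%:R - k%:R)[ ] (\sum_(i < n) X i t)].
    congr (P _); apply/seteqP; split=> t /=;
      rewrite devE eps_def ltr_pM2r ?invr_gt0// in_itv/=; lra.
  rewrite (binomial_law _ _ _ _ _ p)// -sumE; last by lia.
  congr (_%:E); apply: eq_bigl => l; rewrite /= in_itv/=.
  by rewrite ltrBrDr -natrD ltr_nat asboolb ltn_subRL addnC.
have smallE : small_left_deviation X p eps =
    (\sum_(m - k <= l < m) binomial_pmf n p l)%:E.
  have -> : small_left_deviation X p eps =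
      P [set t | [set` `[(m%:R - k%:R), m%:R[ ] (\sum_(i < n) X i t)].
    congr (P _); apply/seteqP; split=> t /=;
      rewrite devE eps_def ler_pM2r ?invr_gt0// pmulr_lgt0 ?invr_gt0//;
      rewrite in_itv/= => /andP[? ?]; apply/andP; split; lra.
  rewrite (binomial_law _ _ _ _ _ p)// -sumE; last by lia.
  congr (_%:E); apply: eq_bigl => l; rewrite /= in_itv/=.
  by rewrite lerBlDr -natrD ler_nat ltr_nat asboolb leq_subLR addnC.
rewrite largeE smallE -EFinM lee_fin mulrBl mul1r lerBlDl.
rewrite -big_cat_nat ?leq_subr//.
exact: (binomial_sum_shift _ m).
Qed.
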